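(* (i) Let $n>1$ be an odd integer. Then $$c_n:=2^{(n-1)/2}\operatorname{per}\left[\cos2\pi\frac{jk}{n}\right]_{1\le j,k\le (n-1)/2}\in\mathbb Z$$ and $$c_n':=2^{-(n-1)/2}\operatorname{per}\left[\sec2\pi\frac{jk}{n}\right]_{1\le j,k\le (n-1)/2}\in\frac{1}{2^{d_n}}\mathbb Z,$$ where $$d_n:=\max_{\tau\in S_{(n-1)/2}}\left|\left\{1\le j\le\frac{n-1}{2}:\ n\mid j\tau(j)\right\}\right|.$$ (ii) For any odd prime $p$, we have $$\operatorname{per}\left[\cos2\pi\frac{jk}{p}\right]_{1\le j,k\le (p-1)/2}\equiv\operatorname{per}\left[\sec2\pi\frac{jk}{p}\right]_{1\le j,k\le (p-1)/2}\equiv\frac{p-1}{2}!\pmod p.$$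
   Context: The permanent of an $N\times N$ matrix $A=[a_{j,k}]$ is $\operatorname{per}(A)=\sum_{\tau\in S_N}\prod_{j=1}^{N}a_{j,\tau(j)}$, where $S_N$ is the symmetric group on $\{1,\ldots,N\}$. $\cos2\pi\frac{m}{n}$ means $\cos(2\pi m/n)$, and $\sec=1/\cos$. $\frac{p-1}{2}!$ means $((p-1)/2)!$. $\frac{1}{2^{d}}\mathbb Z=\{m/2^{d}: m\in\mathbb Z\}$. In part (ii) the permanents are rational numbers with denominators prime to $p$; a congruence modulo $p$ between such numbers means that their difference, divided by $p$, is a rational number with denominator prime to $p$. *)

(* Defs.v *)
From mathcomp Require Import all_boot all_order all_algebra all_fingroup.
From mathcomp Require Import all_classical all_reals all_analysis.

Set Implicit Arguments.
Unset Strict Implicit.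
Unset Printing Implicit Defensive.

Import Order.TTheory GRing.Theory Num.Theory.

Local Open Scope ring_scope.

Definition permanent (R : comNzRingType) (N : nat) (A : 'M[R]_N) : R :=
  \sum_(t : 'S_N) \prod_(j < N) A j (t j).

Definition sec (R : realType) (x : R) : R := (cos x)^-1.

(* Ordinals start at 0, so the row and column numbers 1, ..., (n-1)/2 are the
   successors of the ordinals j and k. *)
Definition cos_mx (R : realType) (n : nat) : 'M[R]_((n - 1) %/ 2) :=
  \matrix_(j, k) cos (2 * pi * ((j.+1 * k.+1)%:R / n%:R)).

(* For odd n no cosine in this matrix vanishes, so the convention 0^-1 = 0
   plays no role. *)
Definition sec_mx (R : realType) (n : nat) : 'M[R]_((n - 1) %/ 2) :=
  \matrix_(j, k) sec (2 * pi * ((j.+1 * k.+1)%:R / n%:R)).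

Definition c (R : realType) (n : nat) : R :=
  2 ^+ ((n - 1) %/ 2) * permanent (cos_mx R n).

Definition c' (R : realType) (n : nat) : R :=
  2 ^- ((n - 1) %/ 2) * permanent (sec_mx R n).

Definition d (n : nat) : nat :=
  \max_(t : 'S_((n - 1) %/ 2))
    #|[set j : 'I_((n - 1) %/ 2) | (n %| j.+1 * (t j).+1)%N]|.

Definition p_integral (R : realType) (p : nat) (x : R) : Prop :=
  exists2 q : rat, x = ratr q & coprime `|denq q| p.

(* Only rational numbers with denominator prime to p are ever congruent, so a
   congruence asserts in particular that both sides are such numbers. *)
Definition congr_mod (R : realType) (p : nat) (x y : R) : Prop :=
  [/\ p_integral p x, p_integral p y & p_integral p ((x - y) / p%:R)].

(* Main.v *)
Require Import Defs.
From mathcomp Require Import all_boot all_order all_algebra all_fingroup.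
From mathcomp Require Import cyclotomic complex ring lra zify.
From mathcomp Require Import all_classical all_reals all_analysis.

Set Implicit Arguments.
Unset Strict Implicit.
Unset Printing Implicit Defensive.

Import Order.TTheory GRing.Theory Num.Theory.

Local Open Scope ring_scope.

(** Let [z = exp (2 pi i / n)] and [N = (n - 1) / 2].  Multiplying each entry
    by 2, respectively by 1/2, turns [c n] and [c' n] into the permanents of
    the matrices with entries [z^m + z^-m] and [(z^m + z^-m)^-1], where
    [m = jk].

    Both permanents are, up to a power of 2, values at [z] of polynomials with
    integer coefficients.  This is clear for [z^m + z^-m].  For the inverse,
    put [y = z^m]; if [y <> 1], then, [n] being odd, the sum of all powers of
    [y^2] with exponents 0, ..., n is [1], and grouping its terms two by two
    gives [(y + y^-1)^-1 = y + y^5 + ... + y^(2n-1)] ([twocos_inv]).  If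
    [y = 1] the entry is 1/2; in the term of a permutation this happens at
    most [d n] times, so [2 ^ d n] clears the denominators.

    Let [P] be one of these polynomials.  Replacing [z] by [z^a], with [a]
    prime to [n], replaces row [j] by row [aj], and as the entries depend only
    on the class of [m] modulo [n] up to sign this permutes the rows, leaving
    the permanent unchanged ([permanent_conj_invariant]).  So [P] takes the
    same value [v] at all roots of the cyclotomic polynomial [Phi_n].  The
    remainder of [P] modulo the monic [Phi_n] has integer coefficients, degree
    below that of [Phi_n], and the value [v] at all the roots of [Phi_n]: it
    is the constant [v], which is therefore an integer
    ([conjugates_eq_const]).

    For [n = p] prime, evaluating [P = Q * Phi_p + v] at 1, where [Phi_p]
    takes the value [p], gives [v = P(1)] modulo [p].  At 1 all entries of the
    matrix become equal, to 2 in the cosine case and to [(p + 1) / 2] in the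
    secant case, and both permanents are congruent to [N!] after division by
    [2^N], respectively multiplication by it. *)

(** * Integer polynomials constant on the primitive roots of unity *)

Lemma Cyclotomic_dvd (d : nat) :
  (0 < d)%N -> exists q : {poly int}, 'X^d - 1 = 'Phi_d * q.
Proof.
move=> d_gt0; rewrite -prod_Cyclotomic //.
rewrite (bigD1_seq d) ?divisors_uniq -?dvdn_divisors //=.
by eexists.
Qed.

(** As [z] is a root of [X^n - 1], the product of the [Phi_d] with [d | n], it
    is a root of some [Phi_d]; then [z^d = 1], which forces [d = n]. *)
Lemma root_Cyclotomic (F : fieldType) (n : nat) (z : F) :
  n.-primitive_root z -> root (map_poly intr 'Phi_n) z.
Proof.
move=> zP; have n_gt0 := prim_order_gt0 zP.
have: (map_poly intr (\prod_(d <- divisors n) 'Phi_d : {poly int})).[z] = 0 :> F.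
  rewrite prod_Cyclotomic // rmorphB rmorph1 /= map_polyXn.
  by rewrite !hornerE (prim_expr_order zP) subrr.
rewrite rmorph_prod horner_prod => /eqP; rewrite prodf_seq_eq0.
case/hasP=> d; rewrite -dvdn_divisors // => d_dvd_n /= root_d.
have d_gt0 := dvdn_gt0 n_gt0 d_dvd_n.
suff zd1 : z ^+ d = 1.
  have n_dvd_d : (n %| d)%N by rewrite (prim_order_dvd zP) zd1.
  by have /eqP <- : d == n by rewrite eqn_dvd d_dvd_n.
have [q Dq] := Cyclotomic_dvd d_gt0.
have: (map_poly intr ('X^d - 1 : {poly int})).[z] = 0 :> F.
  by rewrite Dq rmorphM hornerM (eqP root_d) mul0r.
rewrite rmorphB rmorph1 /= map_polyXn !hornerE => /eqP.
by rewrite subr_eq0 => /eqP.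
Qed.

(** Let [r] be the remainder of [P] modulo [Phi_n]; then [r - v] has degree
    less than [totient n] and vanishes at the [totient n] primitive roots, so
    [r = v].
    The quotient [Q] is recorded because evaluating the identity at 1 gives
    the congruences. *)
Lemma conjugates_eq_const (F : numFieldType) (n : nat) (z : F)
    (P : {poly int}) (v : F) :
    n.-primitive_root z ->
    (forall a, coprime a n -> (map_poly intr P).[z ^+ a] = v) ->
  exists2 m : int, v = m%:~R & exists Q : {poly int}, P = Q * 'Phi_n + m%:P.
Proof.
move=> zP Pv; pose r := Pdiv.Ring.rmodp P 'Phi_n.
have Phi_monic := Cyclotomic_monic n.
have Phi_neq0 : 'Phi_n != 0 := monic_neq0 Phi_monic.
have DP := Pdiv.RingMonic.rdivp_eq Phi_monic P.
have size_r : (size r <= totient n)%N.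
  by rewrite -ltnS -size_Cyclotomic Pdiv.Ring.ltn_rmodpN0.
have r_conj a : coprime a n -> (map_poly intr r).[z ^+ a] = v.
  move=> a_n; rewrite -(Pv _ a_n) DP rmorphD rmorphM /= hornerD hornerM.
  have /root_Cyclotomic/eqP -> : n.-primitive_root (z ^+ a).
    by rewrite prim_root_exp_coprime.
  by rewrite mulr0 add0r.
pose rs := [seq z ^+ a | a <- [seq a <- iota 0 n | coprime n a]].
have r_const : map_poly intr r = v%:P :> {poly F}.
  apply/eqP; rewrite -subr_eq0; apply/negPn/negP => nz.
  suff : (size rs < size rs)%N by rewrite ltnn.
  have size_rs : size rs = totient n.
    rewrite size_map size_filter totient_count_coprime -sum1_count.
    by rewrite big_mkcond /index_iota subn0.
  apply: (@leq_trans (size (map_poly intr r - v%:P : {poly F}))).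
    apply: max_poly_roots => //.
      apply/allP => w /mapP[a]; rewrite mem_filter => /andP[a_n _] ->.
      by rewrite rootE !hornerE r_conj ?subrr // coprime_sym.
    rewrite map_inj_in_uniq ?filter_uniq ?iota_uniq // => a b.
    rewrite !mem_filter !mem_iota !add0n => /andP[_ a_lt] /andP[_ b_lt] /eqP.
    by rewrite (eq_prim_root_expr zP) !modn_small // => /eqP.
  have tot_gt0 : (0 < totient n)%N by rewrite totient_gt0 (prim_order_gt0 zP).
  rewrite size_rs (leq_trans (size_polyD _ _)) // geq_max size_polyN size_polyC.
  rewrite (leq_trans (size_poly _ _) size_r) /=.
  by rewrite (leq_trans (leq_b1 _) tot_gt0).
exists r`_0.
  by have /(congr1 (fun p : {poly F} => p`_0)) := r_const; rewrite coef_map coefC.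
exists (Pdiv.Ring.rdivp P 'Phi_n).
suff Dr : r = (r`_0)%:P by rewrite -Dr.
apply/polyP => i; rewrite coefC; case: eqP => [-> // | /eqP i_neq0].
have /(congr1 (fun p : {poly F} => p`_i)) := r_const.
rewrite coef_map coefC (negPf i_neq0) => /eqP.
by rewrite intr_eq0 => /eqP.
Qed.

(** For [p] prime, [Phi_p] is [1 + X + ... + X^(p-1)]. *)
Lemma Cyclotomic_prime_at1 (p : nat) : prime p -> ('Phi_p).[1] = p%:R.
Proof.
move=> p_pr; have p_gt0 := prime_gt0 p_pr.
have X1 : 'Phi_1 = 'X - 1 :> {poly int}.
  by rewrite -[RHS](@prod_Cyclotomic 1) // big_seq1.
have divisors_p : perm_eq (divisors p) [:: 1%N; p].
  apply: uniq_perm; rewrite ?divisors_uniq //=.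
    by rewrite inE eq_sym neq_ltn prime_gt1 ?orbT.
  move=> d; rewrite -dvdn_divisors // !inE.
  have [_ dvd_p] := primeP p_pr.
  apply/idP/idP => [/dvd_p // | /orP[]/eqP-> //].
have : ('X - 1) * 'Phi_p = ('X - 1) * \sum_(i < p) 'X^i :> {poly int}.
  rewrite -subrX1 -(prod_Cyclotomic p_gt0) -X1.
  by rewrite (perm_big _ divisors_p) big_cons big_seq1.
move/(mulfI (monic_neq0 (monicXsubC 1))) ->.
rewrite horner_sum (eq_bigr (fun=> 1)) ?sumr_const ?card_ord // => i _.
by rewrite hornerXn expr1n.
Qed.

(** * Permanents *)

Lemma permanent_map (T U : comNzRingType) (h : {rmorphism T -> U}) (N : nat)
    (A : 'M[T]_N) :
  permanent (map_mx h A) = h (permanent A).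
Proof.
rewrite /permanent rmorph_sum; apply: eq_bigr => t _; rewrite rmorph_prod.
by apply: eq_bigr => j _; rewrite mxE.
Qed.

Lemma permanentZ (T : comNzRingType) (N : nat) (x : T) (A : 'M[T]_N) :
  permanent (x *: A) = x ^+ N * permanent A.
Proof.
rewrite /permanent mulr_sumr; apply: eq_bigr => t _.
rewrite -[in x ^+ N](card_ord N) -prodr_const -big_split.
by apply: eq_bigr => j _; rewrite mxE.
Qed.

Lemma permanent_const (T : comNzRingType) (N : nat) (x : T) :
  permanent (const_mx x : 'M[T]_N) = x ^+ N * (N`!)%:R.
Proof.
rewrite /permanent (eq_bigr (fun=> x ^+ N)) => [|t _].
  by rewrite sumr_const card_Sn mulr_natr.
by under eq_bigr do rewrite mxE; rewrite prodr_const card_ord.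
Qed.

Lemma permanent_row_perm (T : comNzRingType) (N : nat) (s : 'S_N) (A : 'M[T]_N) :
  permanent (row_perm s A) = permanent A.
Proof.
rewrite /permanent [RHS](reindex_inj (mulgI s^-1%g)) /=.
apply: eq_bigr => t _; rewrite [RHS](reindex_inj (@perm_inj _ s)) /=.
by apply: eq_bigr => j _; rewrite mxE permM permK.
Qed.

(** * Row permutations induced by the units modulo n *)

Definition pm_eqmod (n i j : nat) : bool := (i == j %[mod n]) || (n %| i + j)%N.

Lemma pm_eqmod_sym (n i j : nat) : pm_eqmod n i j = pm_eqmod n j i.
Proof. by rewrite /pm_eqmod eq_sym addnC. Qed.

Lemma pm_eqmod_trans (n j i k : nat) :
  pm_eqmod n i j -> pm_eqmod n j k -> pm_eqmod n i k.
Proof.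
case/orP=> [/eqP ij | ij] /orP[/eqP jk | jk]; apply/orP.
- by left; apply/eqP; rewrite ij.
- by right; rewrite /dvdn -modnDml ij modnDml.
- by right; rewrite /dvdn -modnDmr -jk modnDmr.
- by left; rewrite -(eqn_modDl j) addnC (eqP ij) (eqP jk).
Qed.

Lemma pm_eqmod_mul2l (n a i j : nat) :
  coprime a n -> pm_eqmod n (a * i) (a * j) = pm_eqmod n i j.
Proof.
move=> a_n; wlog ij : i j / (j <= i)%N.
  move=> IH; have [/ltnW|] := ltnP i j => /IH //.
  by rewrite pm_eqmod_sym => ->; rewrite pm_eqmod_sym.
rewrite /pm_eqmod !eqn_mod_dvd ?leq_mul // -mulnBr -mulnDr.
by rewrite !Gauss_dvdr // coprime_sym.
Qed.

Lemma pm_eqmod_mulr (n i j k : nat) :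
  pm_eqmod n i j -> pm_eqmod n (i * k) (j * k).
Proof.
case/orP=> [/eqP ij | ij]; apply/orP.
- by left; rewrite -modnMml ij modnMml.
- by right; rewrite -mulnDl dvdn_mulr.
Qed.

Lemma pm_eqmod_half_inj (n i j : nat) :
  (0 < i)%N -> (i <= (n - 1) %/ 2)%N -> (0 < j)%N -> (j <= (n - 1) %/ 2)%N ->
  pm_eqmod n i j -> i = j.
Proof.
move=> i0 iN j0 jN /orP[|/dvdn_leq le_n]; last by lia.
by rewrite !modn_small; [move/eqP | lia | lia].
Qed.

Lemma pm_eqmod_half_exists (n i : nat) : odd n -> ~~ (n %| i)%N ->
  exists j : 'I_((n - 1) %/ 2), pm_eqmod n j.+1 i.
Proof.
move=> n_odd n_ndvd_i.
have r_gt0 : (0 < i %% n)%N by rewrite lt0n.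
have r_lt : (i %% n < n)%N by rewrite ltn_mod odd_gt0.
have [r_le | r_gt] := leqP (i %% n) ((n - 1) %/ 2).
  have lt : ((i %% n).-1 < (n - 1) %/ 2)%N by lia.
  exists (Ordinal lt); apply/orP; left.
  by rewrite /= prednK // modn_mod.
have lt : ((n - i %% n).-1 < (n - 1) %/ 2)%N by lia.
exists (Ordinal lt); apply/orP; right.
by rewrite /= prednK ?subn_gt0 // /dvdn -modnDmr subnK ?modnn // ltnW.
Qed.

(** The numbers 1, ..., (n-1)/2 represent the nonzero classes modulo [n] up to
    sign, so multiplication by a unit [a] permutes them, up to sign and
    modulo [n]. *)
Lemma permanent_conj_invariant (T : comNzRingType) (n a : nat) (f : nat -> T) :
  odd n -> coprime a n -> (forall i j, pm_eqmod n i j -> f i = f j) ->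
  permanent (\matrix_(j < (n - 1) %/ 2, k < (n - 1) %/ 2)
               f (a * (j.+1 * k.+1))%N) =
  permanent (\matrix_(j < (n - 1) %/ 2, k < (n - 1) %/ 2) f (j.+1 * k.+1)%N).
Proof.
move=> n_odd a_n f_pm; set N := ((n - 1) %/ 2)%N.
have fold (j : 'I_N) : {i : 'I_N | pm_eqmod n i.+1 (a * j.+1)}.
  apply/sigW/pm_eqmod_half_exists => //.
  rewrite Gauss_dvdr 1?coprime_sym // gtnNdvd //.
  by have := ltn_ord j; rewrite /N; lia.
pose s0 j := sval (fold j).
have s0P j : pm_eqmod n (s0 j).+1 (a * j.+1) := svalP (fold j).
have s0_inj : injective s0.
  move=> j k jk; apply/val_inj/succn_inj.
  apply: (@pm_eqmod_half_inj n); rewrite ?ltn_ord //.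
  rewrite -(pm_eqmod_mul2l _ _ a_n); apply: pm_eqmod_trans (s0P k).
  by rewrite -jk pm_eqmod_sym.
rewrite -[RHS](permanent_row_perm (perm s0_inj)); congr permanent.
apply/matrixP => j k; rewrite !mxE permE mulnA; apply: f_pm.
by rewrite pm_eqmod_sym pm_eqmod_mulr.
Qed.

(** * The entries as values of integer polynomials *)

Definition twocos (F : fieldType) (z : F) (m : nat) : F := z ^+ m + z ^- m.

(** The exponent [(n-1)m] stands for [-m], which it equals modulo [n]. *)
Definition twocos_poly (n m : nat) : {poly int} := 'X^m + 'X^(n.-1 * m).

(** At [z^a] this is [1 / (2 cos x) = sec x / 2] for the angle [x] of [z^(am)],
    unless that power is 1; see [twocos_inv]. *)
Definition half_sec_poly (n m : nat) : {poly int} :=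
  \sum_(i < n.+1./2) 'X^(m * (4 * i).+1).

Lemma twocos_pm_eqmod (F : fieldType) (n : nat) (z : F) (i j : nat) :
  z ^+ n = 1 -> pm_eqmod n i j -> twocos z i = twocos z j.
Proof.
move=> zn; have zmod k : z ^+ (k %% n) = z ^+ k := expr_mod k zn.
case/orP => [/eqP ij | ij]; rewrite /twocos.
  by rewrite -(zmod i) ij zmod.
have zij : z ^+ i * z ^+ j = 1 by rewrite -exprD -zmod (eqP ij).
by rewrite (divr1_eq (_ : z ^+ i / z ^- j = 1)) ?invrK // addrC.
Qed.

Lemma horner_twocos_poly (F : fieldType) (n : nat) (z : F) (a m : nat) :
  (0 < n)%N -> z ^+ n = 1 ->
  (map_poly intr (twocos_poly n m)).[z ^+ a] = twocos z (a * m).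
Proof.
move=> n_gt0 zn; rewrite rmorphD /= !map_polyXn !hornerE -!exprM; congr (_ + _).
apply/esym/mulr1_eq; rewrite -exprD.
rewrite (_ : (a * m + a * (n.-1 * m) = n * (a * m))%N); last by nia.
by rewrite exprM zn expr1n.
Qed.

(** Multiplying the sum by [y + y^-1] gives [1 + y^2 + y^4 + ... + y^(2n)], of
    which the first [n] terms cancel, [y^2] being a nontrivial root of unity
    of order dividing the odd number [n]; the last term is 1. *)
Lemma twocos_inv (F : fieldType) (n : nat) (y : F) :
  odd n -> y ^+ n = 1 -> y != 1 ->
  (y + y^-1)^-1 = \sum_(i < n.+1./2) y ^+ (4 * i).+1.
Proof.
move=> n_odd yn y1.
have y0 : y != 0.
  apply: contra_eq_neq yn => ->.
  by rewrite expr0n gtn_eqF ?odd_gt0 // eq_sym oner_neq0.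
have y2n : (y ^+ 2) ^+ n = 1 by rewrite exprAC yn expr1n.
have y2_neq1 : y ^+ 2 != 1.
  apply: contra_neq y1 => y2; rewrite -yn -[n]odd_double_half n_odd.
  by rewrite -mul2n exprD exprM y2 expr1n mulr1.
have geom : \sum_(i < n) (y ^+ 2) ^+ i = 0.
  have := subrX1 (y ^+ 2) n; rewrite y2n subrr => /esym/eqP.
  by rewrite mulf_eq0 subr_eq0 (negPf y2_neq1) => /eqP.
apply: mulr1_eq; rewrite mulr_sumr.
have pair k : \sum_(i < k) (y + y^-1) * y ^+ (4 * i).+1
            = \sum_(i < k.*2) (y ^+ 2) ^+ i.
  elim: k => [|k IH]; first by rewrite !big_ord0.
  rewrite doubleS !big_ord_recr /= IH -addrA; congr (_ + _).
  rewrite mulrDl -exprS [y ^+ _.+1 in X in _ + X]exprS mulKf // -!exprM addrC.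
  by congr (_ ^+ _ + _ ^+ _); lia.
rewrite pair (_ : n.+1./2.*2 = n.+1); last by lia.
by rewrite big_ord_recr /= geom y2n add0r.
Qed.

Lemma horner_half_sec_poly (F : fieldType) (n : nat) (z : F) (a m : nat) :
  odd n -> n.-primitive_root z -> ~~ (n %| a * m)%N ->
  (map_poly intr (half_sec_poly n m)).[z ^+ a] = (twocos z (a * m))^-1.
Proof.
move=> n_odd zP n_am; rewrite /twocos (twocos_inv n_odd); first last.
- by rewrite -(prim_order_dvd zP).
- by rewrite exprAC (prim_expr_order zP) expr1n.
rewrite rmorph_sum horner_sum; apply: eq_bigr => i _ /=.
by rewrite map_polyXn hornerXn -!exprM mulnA.
Qed.

(** * The permanents as values of integer polynomials *)

Definition cos_permanent_poly (n : nat) : {poly int} :=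
  permanent (\matrix_(j < (n - 1) %/ 2, k < (n - 1) %/ 2)
               twocos_poly n (j.+1 * k.+1)).

Lemma horner_cos_permanent_poly (F : fieldType) (n : nat) (z : F) (a : nat) :
  odd n -> z ^+ n = 1 -> coprime a n ->
  (map_poly intr (cos_permanent_poly n)).[z ^+ a] =
  permanent (\matrix_(j < (n - 1) %/ 2, k < (n - 1) %/ 2) twocos z (j.+1 * k.+1)).
Proof.
move=> n_odd zn a_n.
rewrite -(permanent_conj_invariant n_odd a_n) => [|i j]; last exact: twocos_pm_eqmod.
rewrite -permanent_map -horner_evalE -permanent_map; congr permanent.
by apply/matrixP=> j k; rewrite !mxE /= /horner_eval horner_twocos_poly // odd_gt0.
Qed.

(** The rows where the entry selected by [t] is [1 / (2 cos 0) = 1/2]. *)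
Definition degenerate (n : nat) (t : 'S_((n - 1) %/ 2)) : {set 'I_((n - 1) %/ 2)} :=
  [set j : 'I_((n - 1) %/ 2) | (n %| j.+1 * (t j).+1)%N].

(** The term of [t] is [2 ^ d n] times the product of the selected entries,
    those of the degenerate rows having been absorbed into the power of 2. *)
Definition sec_permanent_poly (n : nat) : {poly int} :=
  \sum_(t : 'S_((n - 1) %/ 2)) 2 ^+ (d n - #|degenerate t|) *
    \prod_(j | j \notin degenerate t) half_sec_poly n (j.+1 * (t j).+1).

Lemma degenerate_le_d (n : nat) (t : 'S_((n - 1) %/ 2)) : (#|degenerate t| <= d n)%N.
Proof. exact: (leq_bigmax (F := fun t : 'S_((n - 1) %/ 2) => #|degenerate t|)). Qed.

Lemma horner_sec_permanent_poly (F : numFieldType) (n : nat) (z : F) (a : nat) :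
  odd n -> n.-primitive_root z -> coprime a n ->
  (map_poly intr (sec_permanent_poly n)).[z ^+ a] =
  2 ^+ d n * permanent (\matrix_(j < (n - 1) %/ 2, k < (n - 1) %/ 2)
                          (twocos z (j.+1 * k.+1))^-1).
Proof.
move=> n_odd zP a_n; have zn := prim_expr_order zP.
rewrite -(permanent_conj_invariant (f := fun m => (twocos z m)^-1) n_odd a_n);
  last by move=> i j ij; rewrite (twocos_pm_eqmod zn ij).
rewrite rmorph_sum horner_sum /permanent mulr_sumr; apply: eq_bigr => t _.
rewrite rmorphM rmorphXn rmorph_prod hornerM horner_prod /=.
rewrite [in RHS](bigID (mem (degenerate t))) /= mulrA; congr (_ * _).
  rewrite (eq_bigr (fun=> 2^-1)) => [|j]; last first.
    rewrite inE mxE => n_jt; rewrite (@twocos_pm_eqmod _ n _ _ 0) //.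
      by rewrite /twocos expr0 invr1.
    by rewrite /pm_eqmod addn0 dvdn_mull // orbT.
  rewrite prodr_const rmorph_nat -[2%:R]polyC_natr -polyC_exp hornerC exprVn.
  by rewrite expfB_cond // pnatr_eq0 add0n degenerate_le_d.
apply: eq_bigr => j; rewrite inE mxE => n_jt.
by rewrite horner_half_sec_poly // Gauss_dvdr // coprime_sym.
Qed.

(** * Values at 1 *)

Lemma cos_permanent_poly_at1 (n : nat) :
  (cos_permanent_poly n).[1] = 2 ^+ ((n - 1) %/ 2) * (((n - 1) %/ 2)`!)%:R.
Proof.
rewrite -permanent_const -horner_evalE -permanent_map; congr permanent.
by apply/matrixP=> j k; rewrite !mxE /= /horner_eval !hornerE !expr1n.
Qed.

Lemma degenerate_prime (p : nat) (t : 'S_((p - 1) %/ 2)) :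
  prime p -> degenerate t = finset.set0.
Proof.
move=> p_pr; apply/setP=> j; rewrite !inE Euclid_dvdM //.
have jN := ltn_ord j; have tjN := ltn_ord (t j).
by apply/norP; split; rewrite gtnNdvd //; lia.
Qed.

Lemma d_prime (p : nat) : prime p -> d p = 0%N.
Proof.
move=> p_pr; apply/eqP; rewrite -leqn0; apply/bigmax_leqP => t _.
by rewrite -/(degenerate t) degenerate_prime // cards0.
Qed.

Lemma sec_permanent_poly_at1 (p : nat) : prime p ->
  (sec_permanent_poly p).[1] = (p.+1./2)%:R ^+ ((p - 1) %/ 2) * (((p - 1) %/ 2)`!)%:R.
Proof.
move=> p_pr; rewrite -permanent_const horner_sum; apply: eq_bigr => t _.
rewrite d_prime // degenerate_prime // cards0 mul1r horner_prod.
apply: eq_big => [j|j _]; first by rewrite inE.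
rewrite mxE horner_sum (eq_bigr (fun=> 1)) ?sumr_const ?card_ord // => i _.
by rewrite hornerXn expr1n.
Qed.

(** * From real cosines to powers of a complex root of unity *)

Definition root_of_unity (R : realType) (n : nat) : R[i] :=
  (cos (2 * pi * n%:R^-1) +i* sin (2 * pi * n%:R^-1))%C.

Lemma root_of_unity_exp (R : realType) (n m : nat) :
  root_of_unity R n ^+ m =
  (cos (2 * pi * (m%:R / n%:R)) +i* sin (2 * pi * (m%:R / n%:R)))%C.
Proof.
elim: m => [|m IH]; first by rewrite mul0r mulr0 cos0 sin0.
have -> : 2 * pi * (m.+1%:R / n%:R) = 2 * pi * n%:R^-1 + 2 * pi * (m%:R / n%:R) :> R.
  by rewrite -[m.+1]addn1 natrD; ring.
rewrite exprS IH cosD sinD; apply/eqP; rewrite eq_complex /= eqxx /=.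
by rewrite addrC.
Qed.

Lemma cos_lt1 (R : realType) (x : R) : 0 < x < 2 * pi -> cos x < 1.
Proof.
move=> /andP[x0 x2]; have -> : x = (x / 2) *+ 2 by rewrite -mulr_natr divfK ?pnatr_eq0.
have s0 : 0 < sin (x / 2) by apply: sin_gt0_pi; apply/andP; split; lra.
have := cos2Dsin2 (x / 2); have : 0 < sin (x / 2) ^+ 2 by rewrite exprn_gt0.
by rewrite cos_mulr2n; lra.
Qed.

Lemma root_of_unity_prim (R : realType) (n : nat) :
  (0 < n)%N -> n.-primitive_root (root_of_unity R n).
Proof.
move=> n_gt0; have n0 : 0 < n%:R :> R by rewrite ltr0n.
apply/andP; split=> //; apply/forallP=> i; rewrite unity_rootE; apply/eqP.
rewrite root_of_unity_exp; have [-> | i_neq] := eqVneq i.+1 n.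
  by rewrite (divff (lt0r_neq0 n0)) mulr1 mulr_natl cos2pi sin2pi; apply/eqP.
apply/negbTE/negP => /eqP[cos_eq1 _].
suff : cos (2 * pi * (i.+1%:R / n%:R)) < 1 :> R by rewrite cos_eq1 ltxx.
apply: cos_lt1.
have i_lt : (i.+1 < n)%N by rewrite ltn_neqAle i_neq ltn_ord.
have tau_gt0 : 0 < 2 * pi :> R by rewrite mulr_gt0 ?pi_gt0.
apply/andP; split; first by rewrite mulr_gt0 ?divr_gt0 ?ltr0n.
by rewrite gtr_pMr // ltr_pdivrMr // mul1r ltr_nat.
Qed.

Lemma twocos_root_of_unity (R : realType) (n m : nat) :
  twocos (root_of_unity R n) m = (2 * cos (2 * pi * (m%:R / n%:R)))%:C%C.
Proof.
rewrite /twocos root_of_unity_exp; set x := 2 * pi * _.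
have -> : ((cos x +i* sin x)^-1 = cos x -i* sin x)%C.
  apply: mulr1_eq; apply/eqP; rewrite eq_complex /=; apply/andP; split; apply/eqP.
    by rewrite mulrN opprK -!expr2 cos2Dsin2.
  by rewrite mulrN mulrC addNr.
by apply/eqP; rewrite eq_complex /= subrr eqxx andbT mulr_natl mulr2n.
Qed.

Lemma c_permanent (R : realType) (n : nat) :
  (c R n)%:C%C = permanent (\matrix_(j < (n - 1) %/ 2, k < (n - 1) %/ 2)
                    twocos (root_of_unity R n) (j.+1 * k.+1)).
Proof.
rewrite /c -permanentZ -[LHS]permanent_map; congr permanent.
by apply/matrixP=> j k; rewrite !mxE twocos_root_of_unity.
Qed.

Lemma c'_permanent (R : realType) (n : nat) :
  (c' R n)%:C%C = permanent (\matrix_(j < (n - 1) %/ 2, k < (n - 1) %/ 2)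
                    (twocos (root_of_unity R n) (j.+1 * k.+1))^-1).
Proof.
rewrite /c' -exprVn -permanentZ -[LHS]permanent_map; congr permanent.
by apply/matrixP=> j k; rewrite !mxE twocos_root_of_unity -fmorphV invfM.
Qed.

(** * Integrality *)

Lemma c_int (R : realType) (n : nat) : odd n ->
  exists2 m : int, c R n = m%:~R &
    exists Q : {poly int}, cos_permanent_poly n = Q * 'Phi_n + m%:P.
Proof.
move=> n_odd; have zP := root_of_unity_prim R (odd_gt0 n_odd).
have [|m cm Qm] := conjugates_eq_const (P := cos_permanent_poly n)
    (v := (c R n)%:C%C) zP.
  move=> a a_n; rewrite c_permanent.
  exact: horner_cos_permanent_poly n_odd (prim_expr_order zP) a_n.
exists m => //; apply: complexI; rewrite cm; exact/esym/rmorph_int.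
Qed.

Lemma c'_int (R : realType) (n : nat) : odd n ->
  exists2 m : int, 2 ^+ d n * c' R n = m%:~R &
    exists Q : {poly int}, sec_permanent_poly n = Q * 'Phi_n + m%:P.
Proof.
move=> n_odd; have zP := root_of_unity_prim R (odd_gt0 n_odd).
have [|m cm Qm] := conjugates_eq_const (P := sec_permanent_poly n)
    (v := (2 ^+ d n * c' R n)%:C%C) zP.
  move=> a a_n; rewrite rmorphM rmorphXn rmorph_nat /= c'_permanent.
  exact: horner_sec_permanent_poly n_odd zP a_n.
exists m => //; apply: complexI; rewrite cm; exact/esym/rmorph_int.
Qed.

(** * Congruences modulo a prime *)

Lemma p_integral_frac (R : realType) (p k : nat) (m : int) :
  (0 < k)%N -> coprime k p -> p_integral p (m%:~R / k%:R : R).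
Proof.
move=> k0 kp; exists (m%:~R / k%:R).
  by rewrite rmorphM fmorphV /= ratr_int ratr_nat.
rewrite -[k%:R]/((Posz k)%:~R); have : Posz k != 0 by rewrite -lt0n.
move: kp; rewrite -[k]/(`|Posz k|%N); move: (Posz k) => l.
case: divqP => [_ _ | u x _ + _]; first by rewrite eqxx.
by rewrite abszM coprimeMl => /andP[].
Qed.

Lemma congr_mod_frac (R : realType) (p k : nat) (x y : R) (m m' q : int) :
  (0 < p)%N -> (0 < k)%N -> coprime k p ->
  x = m%:~R / k%:R -> y = m'%:~R / k%:R -> m - m' = q * p%:Z ->
  congr_mod p x y.
Proof.
move=> p0 k0 kp -> -> mm'; split; try exact: p_integral_frac.
rewrite -mulrBl -rmorphB mm' rmorphM mulrAC /= -[p%:Z%:~R]/(p%:R).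
rewrite mulfK ?pnatr_eq0 -?lt0n //.
exact: p_integral_frac.
Qed.

Lemma permanent_cosE (R : realType) (n : nat) :
  permanent (cos_mx R n) = c R n / 2 ^+ ((n - 1) %/ 2).
Proof. by rewrite /c mulrC mulKf // expf_neq0 // pnatr_eq0. Qed.

Lemma permanent_secE (R : realType) (n : nat) :
  permanent (sec_mx R n) = 2 ^+ ((n - 1) %/ 2) * c' R n.
Proof. by rewrite /c' mulVKf // expf_neq0 // pnatr_eq0. Qed.

Theorem theorem5 (R : realType) :
  (forall n : nat, (1 < n)%N -> odd n ->
     c R n \is a Num.int /\
     (exists m : int, c' R n = m%:~R / 2 ^+ d n)) /\
  (forall p : nat, prime p -> odd p ->
     congr_mod p (permanent (cos_mx R p)) (permanent (sec_mx R p)) /\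
     congr_mod p (permanent (sec_mx R p)) (((p - 1) %/ 2)`!)%:R).
Proof.
split=> [n _ n_odd | p p_pr p_odd].
  split; first by have [m -> _] := c_int R n_odd; exact: intr_int.
  have [m cm _] := c'_int R n_odd; exists m.
  by rewrite -cm mulrC mulKf // expf_neq0 // pnatr_eq0.
have p_gt0 := prime_gt0 p_pr.
have [m cm [Q DQ]] := c_int R p_odd.
have [m' cm' [Q' DQ']] := c'_int R p_odd.
rewrite d_prime // mul1r in cm'.
move: DQ DQ' => /(congr1 (horner^~ 1)) + /(congr1 (horner^~ 1)).
rewrite !hornerD !hornerM !hornerC Cyclotomic_prime_at1 //.
rewrite cos_permanent_poly_at1 sec_permanent_poly_at1 //.
set N := ((p - 1) %/ 2)%N; set q := Q.[1]; set q' := Q'.[1] => Dm Dm'.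
(* [s] is [((p + 1)^N - 1) / p], so that [2^N ((p + 1) / 2)^N] is [1 + p s]. *)
pose s : int := \sum_(i < N) (p.+1)%:R ^+ i.
have Ds : 2 ^+ N * p.+1./2%:R ^+ N = 1 + p%:R * s :> int.
  rewrite -exprMn -natrM (_ : 2 * p.+1./2 = p.+1)%N; last by lia.
  rewrite -[LHS](subrK 1) subrX1 [LHS]addrC; congr (_ + _ * _).
  by rewrite -natr1 addrK.
have two_p : coprime (2 ^ N) p by rewrite coprimeXl // coprime2n.
rewrite permanent_cosE permanent_secE cm cm' -/N.
split.
  (* The last witness, the difference of the numerators divided by [p], results
     from substituting [Dm], [Dm'] and [Ds] into that difference. *)
  apply: (@congr_mod_frac _ p (2 ^ N) _ _ m (2 ^+ N * 2 ^+ N * m')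
    (2 ^+ N * 2 ^+ N * q' - q - 2 ^+ N * s * (N`!)%:R)) => //.
  - by rewrite expn_gt0.
  - by rewrite natrX.
  - rewrite natrX !rmorphM rmorphXn rmorph_nat -[X in X / _]mulrA [X in X / _]mulrC.
    by rewrite mulfK // expf_neq0 // pnatr_eq0.
  - rewrite (_ : m = 2 ^+ N * (N`!)%:R - q * p%:R);
      last by rewrite Dm addrC addKr.
    rewrite (_ : m' = p.+1./2%:R ^+ N * (N`!)%:R - q' * p%:R);
      last by rewrite Dm' addrC addKr.
    rewrite mulrBr [_ * _ * (_ * _)]mulrACA Ds natz; ring.
apply: (@congr_mod_frac _ p 1 _ _ (2 ^+ N * m') (N`!)%:R
    (s * (N`!)%:R - 2 ^+ N * q')) => //; rewrite ?coprime1n ?divr1 //.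
- by rewrite rmorphM rmorphXn.
- by rewrite rmorph_nat.
- rewrite (_ : m' = p.+1./2%:R ^+ N * (N`!)%:R - q' * p%:R);
      last by rewrite Dm' addrC addKr.
  by rewrite mulrBr mulrA Ds natz; ring.
Qed.
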